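(* Let $\beta_j=j-\frac12$ for $j=1,2,\dots$. Define functions $f_j$ of $x$ by $$f_1=-x+\frac12,\qquad f_{j+1}=\beta_{j+1}+\frac{x^2}{f_j+\beta_j}\quad (j\ge 1).$$ Then for every $j\ge1$ the function $f_j$ is a (well-defined) rational function of $x$ which, with $x=e^{-t}$, is a solution of the Riccati equation $$\frac{d f_j}{dt}+f_j^2=\beta_j^2+x^2 .$$ In particular, $$f_2=\frac32+\frac{x^2}{1-x},\qquad f_3=\frac52+\frac{x^2(1-x)}{x^2-3x+3},\qquad f_4=\frac72+\frac{x^2(x^2-3x+3)}{-x^3+6x^2-15x+15}.$$
   Context: The variables are related by $x=e^{-t}$, so $\frac{d}{dt}=-x\frac{d}{dx}$; the Riccati equation is understood as an identity of rational functions in $x$, i.e. $-x\,\frac{df_j}{dx}+f_j^2=\beta_j^2+x^2$. *)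

(* Defs.v *)
From HB Require Import structures.
From mathcomp Require Import all_boot all_order all_algebra.
From mathcomp Require Import ring.

Set Implicit Arguments.
Unset Strict Implicit.
Unset Printing Implicit Defensive.

Import Order.TTheory GRing.Theory Num.Theory.
Local Open Scope ring_scope.
Local Open Scope quotient_scope.

Notation ratfun R := {fraction {poly R}}.

Local Notation "p %:F" := (FracField.tofrac p).

Definition ratX (R : fieldType) : ratfun R := 'X%:F.

(* Quotient rule on the representative fraction chosen by the quotient type;
   [ratderivE] shows that the result does not depend on that choice. *)
Definition ratderiv (R : fieldType) (f : ratfun R) : ratfun R :=
  let n := \n_(repr f) in
  let d := \d_(repr f) in
  (n^`() * d - n * d^`())%:F / (d ^+ 2)%:F.

Lemma ratderivE (R : fieldType) (p q : {poly R}) : q != 0 ->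
  ratderiv (p%:F / q%:F) =
  (p^`() * q - p * q^`())%:F / (q ^+ 2)%:F.
Proof.
move=> q0; rewrite /ratderiv; set f : ratfun R := p%:F / q%:F.
set n := \n_(repr f); set d := \d_(repr f).
have d0 : d != 0 by exact: denom_ratioP.
have tF (r : {poly R}) : r != 0 -> r%:F != 0.
  by rewrite tofrac_eq0.
have fE : f = n%:F / d%:F.
  rewrite -[LHS]reprK -[RHS]/(FracField.mul _ (FracField.inv _)) !piE.
  apply/eqP; rewrite FracField.equivf_def /FracField.mulf /FracField.invf.
  by rewrite !numden_Ratio ?mul1r ?mulr1 ?oner_neq0 // mulrC.
have npq : n * q = p * d.
  apply/eqP; rewrite -tofrac_eq !tofracM -eqr_div ?tF //.
  by apply/eqP; rewrite -fE.
have dnpq : n^`() * q + n * q^`() = p^`() * d + p * d^`().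
  by rewrite -!derivM npq.
apply/eqP; rewrite eqr_div ?tF ?expf_neq0 // -!tofracM tofrac_eq -subr_eq0.
have -> : (n^`() * d - n * d^`()) * q ^+ 2 - (p^`() * q - p * q^`()) * d ^+ 2
  = (n^`() * q + n * q^`() - (p^`() * d + p * d^`())) * (d * q)
    - (n * q - p * d) * (d^`() * q + q^`() * d) by ring.
by rewrite dnpq npq !subrr !mul0r subr0.
Qed.

(* The derivation d/dt on rational functions of x = exp(-t). *)
Definition ddt (R : fieldType) (f : ratfun R) : ratfun R :=
  - ratX R * ratderiv f.

Definition beta (K : fieldType) (j : nat) : K := j%:R - 1 / 2.

(* The family is indexed from 1; the value at index 0 is irrelevant. Division
   in the field is total, so the recursive clause is a genuine definition of
   f_(j+1) exactly when f_j + beta_j is nonzero. *)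
Fixpoint riccati_f (R : fieldType) (j : nat) : ratfun R :=
  match j with
  | 0 => 0
  | 1 => - ratX R + 1 / 2
  | i.+1 => beta _ i.+1 + ratX R ^+ 2 / (riccati_f R i + beta _ i)
  end.

(* Main.v *)
Require Import Defs.
From HB Require Import structures.
From mathcomp Require Import all_boot all_order all_algebra.
From mathcomp Require Import ring.
Import Order.TTheory GRing.Theory Num.Theory.
Local Open Scope ring_scope.

(** Put [g_j = f_j + beta_j].  The recursion becomes
    [g_(j+1) = 2 beta_(j+1) + x^2 / g_j] and, after cancelling [beta_j^2], the
    Riccati equation becomes [dg_j/dt + g_j^2 - 2 beta_j g_j = x^2].  Two facts
    are propagated along this recursion.

    - Well-definedness: [g_j] is a quotient of two polynomials that do not
      vanish at [x = 0] ([regular_unit0]).  This survives the recursion since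
      the term [x^2 / g_j] vanishes at the origin, leaving
      [2 beta_(j+1) = 2j + 1], which is nonzero in characteristic 0.
    - The differential equation: [d/dt] is a derivation with [dx/dt = - x], and
      the substitution [g |-> 2 (b + 1) + x^2 / g] carries solutions of the
      equation with parameter [b] to solutions with parameter [b + 1]
      ([derivation_riccati_step]).  This is the classical fact that a Moebius
      substitution transforms one Riccati equation into another; here it shifts
      [beta] by one.

    The closed forms come from unrolling the recursion: the denominator of
    [f_(j+1)] is the numerator of [g_j], so it is nonzero because [g_j] is. *)

Local Notation "p %:F" := (FracField.tofrac p).

(** * Riccati equations over a differential field *)

Section DifferentialField.
Variables (F : fieldType) (d : F -> F).
Hypothesis dD : forall u v, d (u + v) = d u + d v.
Hypothesis dM : forall u v, d (u * v) = d u * v + u * d v.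

Lemma derivation0 : d 0 = 0.
Proof. by apply: (addrI (d 0)); rewrite -dD !addr0. Qed.

Lemma derivation1 : d 1 = 0.
Proof.
apply: (addrI (d 1)); rewrite addr0.
by rewrite -{3}(mulr1 1) dM mulr1 mul1r.
Qed.

Lemma derivation_nat n : d n%:R = 0.
Proof.
elim: n => [|n IHn]; first exact: derivation0.
by rewrite -natr1 dD IHn derivation1 addr0.
Qed.

Lemma derivationN u : d (- u) = - d u.
Proof. by apply/eqP; rewrite -addr_eq0 -dD addNr derivation0. Qed.

Lemma derivationV u : u != 0 -> d u^-1 = - d u / u ^+ 2.
Proof.
move=> u0; have /eqP : d (u * u^-1) = 0 by rewrite divff // derivation1.
rewrite dM addrC addr_eq0 => /eqP duV.
by rewrite -[LHS](mulKf u0) duV; field.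
Qed.

Lemma derivation_natV n : d n%:R^-1 = 0.
Proof.
have [->|n0] := eqVneq (n%:R : F) 0; first by rewrite invr0 derivation0.
by rewrite derivationV // derivation_nat oppr0 mul0r.
Qed.

Lemma derivation_beta j : d (beta F j) = 0.
Proof.
by rewrite /beta div1r dD derivationN derivation_nat derivation_natV subr0.
Qed.

(** The new quadratic part [h^2 - 2 (b + 1) h] equals [h * (x^2 / g)].  After
    [d g] is replaced by its value from the equation for [g], everything except
    [x^2] cancels. *)
Lemma derivation_riccati_step (x b g : F) :
  d x = - x -> d b = 0 -> g != 0 ->
  d g + g ^+ 2 - 2 * b * g = x ^+ 2 ->
  let h := 2 * (b + 1) + x ^+ 2 / g in
  d h + h ^+ 2 - 2 * (b + 1) * h = x ^+ 2.
Proof.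
move=> dx db g0 eq_g h.
have -> : d h = - 2 * x ^+ 2 / g - x ^+ 2 * d g / g ^+ 2.
  rewrite /h dD [d (2 * _)]dM derivation_nat dD db derivation1.
  by rewrite dM derivationV // expr2 dM dx; field.
have -> : d g = x ^+ 2 - g ^+ 2 + 2 * b * g by rewrite -eq_g; ring.
by rewrite /h; field.
Qed.

(** Completing the square: the equation for [f + b] is the Riccati equation
    for [f]. *)
Lemma derivation_riccati_shift (x b f : F) : d b = 0 ->
  d (f + b) + (f + b) ^+ 2 - 2 * b * (f + b) = x ^+ 2 ->
  d f + f ^+ 2 = b ^+ 2 + x ^+ 2.
Proof. by move=> db <-; rewrite dD db; ring. Qed.

(** The coefficient [1] of the linear term is [2 beta_1]. *)
Lemma derivation_riccati_init (x : F) : d x = - x ->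
  d (1 - x) + (1 - x) ^+ 2 - 1 * (1 - x) = x ^+ 2.
Proof. by move=> dx; rewrite dD derivationN derivation1 dx; ring. Qed.

End DifferentialField.

(** * Field identities for the recursion *)

Section FieldIdentities.
Variable F : fieldType.
Implicit Types x : F.

Lemma betaS j : beta F j.+1 = beta F j + 1.
Proof. by rewrite /beta -natr1 addrAC. Qed.

Lemma beta_double j : (2 : F) != 0 -> 2 * beta F j.+1 = (j.*2.+1)%:R.
Proof. by move=> n2; rewrite /beta -mul2n -!natr1 natrM; field. Qed.

Lemma beta_half j : (2 : F) != 0 -> beta F j.+1 = (j.*2.+1)%:R / 2.
Proof. by move=> n2; rewrite -beta_double // mulrC mulKf. Qed.

Lemma shifted_initE x : - x + 1 / 2 + beta F 1 = 1 - x.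
Proof. by rewrite /beta; ring. Qed.

Lemma shifted_stepE (b u : F) : b + u + b = 2 * b + u.
Proof. by ring. Qed.

Lemma shifted2E x : 1 - x != 0 ->
  3 + x ^+ 2 / (1 - x) = (x ^+ 2 - 3 * x + 3) / (1 - x).
Proof. by move=> d2; field. Qed.

Lemma shifted3E x : x ^+ 2 - 3 * x + 3 != 0 ->
  5 + x ^+ 2 * (1 - x) / (x ^+ 2 - 3 * x + 3) =
  (- x ^+ 3 + 6 * x ^+ 2 - 15 * x + 15) / (x ^+ 2 - 3 * x + 3).
Proof. by move=> d3; field. Qed.

Lemma div_invf (a u v : F) : a / (u / v) = a * v / u.
Proof. by rewrite invf_div mulrA. Qed.

End FieldIdentities.

(** * Quotients of ring elements in a field *)

(** The identities below hold for any ring morphism into a field.  In this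
    abstract form [field] sees only atoms; on the quotient type of fractions it
    would be led to unfold the construction. *)
Section Quotients.
Variables (A : comNzRingType) (F : fieldType) (phi : {rmorphism A -> F}).
Implicit Types p q r s : A.

Lemma quotientD p q r s : phi q != 0 -> phi s != 0 ->
  phi p / phi q + phi r / phi s = phi (p * s + r * q) / phi (q * s).
Proof. by move=> q0 s0; rewrite rmorphD !rmorphM addf_div. Qed.

Lemma quotientM p q r s :
  phi p / phi q * (phi r / phi s) = phi (p * r) / phi (q * s).
Proof. by rewrite !rmorphM mulf_div. Qed.

Lemma quotient_step c t p q : phi p != 0 -> phi q != 0 ->
  phi c + phi t ^+ 2 / (phi p / phi q) = phi (c * p + t ^+ 2 * q) / phi p.
Proof.
by move=> p0 q0; rewrite rmorphD !rmorphM; field; rewrite p0 q0.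
Qed.

(** The quotient rule, written for formal derivatives [dp], ..., [ds], is
    compatible with sums and products of quotients. *)
Lemma quotient_ruleD p q r s dp dq dr ds : phi q != 0 -> phi s != 0 ->
  phi (((dp * s + p * ds) + (dr * q + r * dq)) * (q * s) -
       (p * s + r * q) * (dq * s + q * ds)) / phi ((q * s) ^+ 2) =
  phi (dp * q - p * dq) / phi (q ^+ 2) + phi (dr * s - r * ds) / phi (s ^+ 2).
Proof.
move=> q0 s0; rewrite !(rmorphB, rmorphXn, rmorphM, rmorphD).
by field; rewrite q0 s0.
Qed.

Lemma quotient_ruleM p q r s dp dq dr ds : phi q != 0 -> phi s != 0 ->
  phi ((dp * r + p * dr) * (q * s) - (p * r) * (dq * s + q * ds)) /
    phi ((q * s) ^+ 2) =
  phi (dp * q - p * dq) / phi (q ^+ 2) * (phi r / phi s) +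
    phi p / phi q * (phi (dr * s - r * ds) / phi (s ^+ 2)).
Proof.
move=> q0 s0; rewrite !(rmorphB, rmorphXn, rmorphM, rmorphD).
by field; rewrite q0 s0.
Qed.

End Quotients.

(** * The derivation on rational functions *)

Section RationalFunctions.
Variable R : fieldType.
Implicit Types (f g : ratfun R) (p q : {poly R}).

Lemma ratfunP f : exists p q, q != 0 /\ f = p%:F / q%:F.
Proof.
exists \n_(repr f)%qT, \d_(repr f)%qT.
have d0 : \d_(repr f)%qT != 0 by exact: denom_ratioP.
split=> //.
rewrite -[LHS]reprK -[RHS]/(FracField.mul _ (FracField.inv _)) !piE.
apply/eqP; rewrite FracField.equivf_def /FracField.mulf /FracField.invf.
by rewrite !numden_Ratio ?mul1r ?mulr1 ?oner_neq0 // mulrC.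
Qed.

Lemma ratderiv_poly p : ratderiv p%:F = p^`()%:F.
Proof.
rewrite -[p%:F]divr1 -[1]tofrac1 ratderivE ?oner_neq0 //.
by rewrite derivC mulr0 subr0 mulr1 expr1n tofrac1 divr1.
Qed.


Lemma ratderivD f g : ratderiv (f + g) = ratderiv f + ratderiv g.
Proof.
have [p [q [q0 ->]]] := ratfunP f; have [r [s [s0 ->]]] := ratfunP g.
have qF : q%:F != 0 by rewrite tofrac_eq0.
have sF : s%:F != 0 by rewrite tofrac_eq0.
rewrite (quotientD _ _ (@FracField.tofrac {poly R}) p q r s qF sF).
rewrite (ratderivE _ q0) (ratderivE _ s0).
rewrite (ratderivE _ (mulf_neq0 q0 s0)) derivD !derivM.
exact: (quotient_ruleD _ _ (@FracField.tofrac {poly R}) p q r s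
          p^`() q^`() r^`() s^`() qF sF).
Qed.

Lemma ratderivM f g : ratderiv (f * g) = ratderiv f * g + f * ratderiv g.
Proof.
have [p [q [q0 ->]]] := ratfunP f; have [r [s [s0 ->]]] := ratfunP g.
have qF : q%:F != 0 by rewrite tofrac_eq0.
have sF : s%:F != 0 by rewrite tofrac_eq0.
rewrite (quotientM _ _ (@FracField.tofrac {poly R}) p q r s).
rewrite (ratderivE _ q0) (ratderivE _ s0).
rewrite (ratderivE _ (mulf_neq0 q0 s0)) !derivM.
exact: (quotient_ruleM _ _ (@FracField.tofrac {poly R}) p q r s
          p^`() q^`() r^`() s^`() qF sF).
Qed.

Lemma ddtD f g : ddt (f + g) = ddt f + ddt g.
Proof. by rewrite /ddt ratderivD mulrDr. Qed.

Lemma ddtM f g : ddt (f * g) = ddt f * g + f * ddt g.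
Proof. by rewrite /ddt ratderivM mulrDr mulrA [X in _ + X]mulrCA. Qed.

Lemma ddtX : ddt (ratX R) = - ratX R.
Proof. by rewrite /ddt ratderiv_poly derivX tofrac1 mulr1. Qed.

(** [f] is regular and nonzero at the origin: a unit of the local ring of
    rational functions at [x = 0]. *)
Definition regular_unit0 f :=
  exists p q, [/\ p.[0] != 0, q.[0] != 0 & f = p%:F / q%:F].

Lemma tofrac_neq0_at0 p : p.[0] != 0 -> p%:F != 0.
Proof. by rewrite tofrac_eq0; apply: contraNneq => ->; rewrite horner0. Qed.

Lemma regular_unit0_neq0 f : regular_unit0 f -> f != 0.
Proof.
move=> [p [q [p0 q0 ->]]]; apply: mulf_neq0; first exact: tofrac_neq0_at0.
by rewrite invr_eq0; exact: tofrac_neq0_at0.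
Qed.

Lemma regular_unit0_step (c : R) f : c != 0 -> regular_unit0 f ->
  regular_unit0 (c%:P%:F + ratX R ^+ 2 / f).
Proof.
move=> c0 [p [q [p0 q0 ->]]].
exists (c%:P * p + 'X ^+ 2 * q), p; split=> //.
  by rewrite !hornerE expr0n /= mul0r addr0 mulf_neq0.
exact: (quotient_step _ _ (@FracField.tofrac {poly R}) c%:P 'X p q
          (tofrac_neq0_at0 p p0) (tofrac_neq0_at0 q q0)).
Qed.

End RationalFunctions.

(** * The recursively defined family *)

Section Family.
Variable R : numFieldType.
Local Notation x := (ratX R).
Local Notation f := (riccati_f R).
Local Notation b := (beta (ratfun R)).

Lemma natr_ratfun n : (n%:R : ratfun R) = (n%:R%:P)%:F.
Proof. by rewrite polyC_natr rmorph_nat. Qed.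

Lemma two_neq0 : (2 : ratfun R) != 0.
Proof.
by rewrite natr_ratfun; apply: tofrac_neq0_at0; rewrite hornerC pnatr_eq0.
Qed.

Lemma shifted1 : f 1 + b 1 = 1 - x.
Proof. exact: shifted_initE. Qed.

Lemma riccati_fS j : f j.+2 = b j.+2 + x ^+ 2 / (f j.+1 + b j.+1).
Proof. by []. Qed.

Lemma shiftedS j :
  f j.+2 + b j.+2 = 2 * b j.+2 + x ^+ 2 / (f j.+1 + b j.+1).
Proof. exact: shifted_stepE. Qed.

(** In the inductive step the constant term [2 beta_(j+2) = 2j + 3] is a
    nonzero scalar because [R] has characteristic 0. *)
Lemma shifted_regular j : regular_unit0 R (f j.+1 + b j.+1).
Proof.
elim: j => [|j IHj].
  rewrite shifted1; exists (1 - 'X), 1.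
  split; [by rewrite !hornerE subr0 oner_neq0 | by rewrite hornerC oner_neq0 |].
  by rewrite tofracB tofrac1 divr1.
rewrite shiftedS (beta_double _ _ two_neq0) natr_ratfun.
by apply: regular_unit0_step; rewrite ?pnatr_eq0.
Qed.

Lemma shifted_neq0 j : f j.+1 + b j.+1 != 0.
Proof. exact/regular_unit0_neq0/shifted_regular. Qed.

Lemma ddt_beta j : ddt (b j) = 0.
Proof. exact: (derivation_beta _ _ (ddtD R) (ddtM R)). Qed.

Lemma shifted_riccati j (g := f j.+1 + b j.+1) :
  ddt g + g ^+ 2 - 2 * b j.+1 * g = x ^+ 2.
Proof.
rewrite {}/g; elim: j => [|j IHj].
  rewrite shifted1 (beta_double _ 0 two_neq0).
  exact: (derivation_riccati_init _ _ (ddtD R) (ddtM R) _ (ddtX R)).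
rewrite shiftedS betaS.
exact: (derivation_riccati_step _ _ (ddtD R) (ddtM R) _ _ _
          (ddtX R) (ddt_beta _) (shifted_neq0 j) IHj).
Qed.

Lemma riccati_f_riccati j :
  ddt (f j.+1) + f j.+1 ^+ 2 = b j.+1 ^+ 2 + x ^+ 2.
Proof.
exact: (derivation_riccati_shift _ _ (ddtD R) _ _ _
          (ddt_beta _) (shifted_riccati j)).
Qed.

Lemma shifted2 : f 2 + b 2 = (x ^+ 2 - 3 * x + 3) / (1 - x).
Proof.
rewrite shiftedS shifted1 (beta_double _ 1 two_neq0).
by apply: shifted2E; rewrite -shifted1; exact: shifted_neq0.
Qed.

(** The quadratic denominator is nonzero since it is the numerator of
    [f 2 + b 2]. *)
Lemma shifted3 :
  f 3 + b 3 = (- x ^+ 3 + 6 * x ^+ 2 - 15 * x + 15) / (x ^+ 2 - 3 * x + 3).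
Proof.
rewrite shiftedS shifted2 (beta_double _ 2 two_neq0) div_invf.
apply: shifted3E; apply: contraNneq (shifted_neq0 1) => d3.
by rewrite shifted2 d3 mul0r.
Qed.

Lemma riccati_f2 : f 2 = 3 / 2 + x ^+ 2 / (1 - x).
Proof. by rewrite riccati_fS shifted1 (beta_half _ 1 two_neq0). Qed.

Lemma riccati_f3 :
  f 3 = 5 / 2 + x ^+ 2 * (1 - x) / (x ^+ 2 - 3 * x + 3).
Proof. by rewrite riccati_fS shifted2 (beta_half _ 2 two_neq0) div_invf. Qed.

Lemma riccati_f4 :
  f 4 = 7 / 2 + x ^+ 2 * (x ^+ 2 - 3 * x + 3)
                / (- x ^+ 3 + 6 * x ^+ 2 - 15 * x + 15).
Proof. by rewrite riccati_fS shifted3 (beta_half _ 3 two_neq0) div_invf. Qed.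

End Family.

Theorem mainTheorem4 (R : numFieldType) :
  let x := ratX R in
  let f := riccati_f R in
  (forall j : nat, (1 <= j)%N ->
     f j + beta _ j != 0 /\
     ddt (f j) + f j ^+ 2 = beta _ j ^+ 2 + x ^+ 2) /\
  f 2%N = 3 / 2 + x ^+ 2 / (1 - x) /\
  f 3%N = 5 / 2 + x ^+ 2 * (1 - x) / (x ^+ 2 - 3 * x + 3) /\
  f 4%N = 7 / 2 + x ^+ 2 * (x ^+ 2 - 3 * x + 3)
                  / (- x ^+ 3 + 6 * x ^+ 2 - 15 * x + 15).
Proof.
move=> x f; split.
  case=> // j _; split; [exact: shifted_neq0 | exact: riccati_f_riccati].
by split; [exact: riccati_f2 | split; [exact: riccati_f3 | exact: riccati_f4]].
Qed.
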